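(* Let $f:\mathbb{R}^n\to\mathbb{R}^n$ and $h:\mathbb{R}^n\to\mathbb{R}^p$ define the autonomous system $\dot x=f(x)$, $y=h(x)$, with solution $\varphi(t,0,x_0)$ starting from $x_0$ at $t=0$, and let $\Omega\subset\mathbb{R}^n$ be a compact set of permissible initial conditions, subject to the standing assumptions in the context (in particular, solutions starting in $\Omega$ are defined on $[0,\tau)$, $0<\tau\le\infty$). If the system is D-observable with respect to $\Omega$ and R-observable with respect to $\Omega$, then it is K-observable with respect to $\Omega$; that is, there exist $T$ with $0<T<\tau$ and a $\mathcal{K}$-function $\alpha$ such that for all $x_1,x_2\in\Omega$, $$\int_0^T\left|h(\varphi(t,0,x_1))-h(\varphi(t,0,x_2))\right|^2dt\ \ge\ \alpha(|x_1-x_2|).$$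
   Context: Setting and standing assumptions. Consider $\dot x=f(x)$, $y=h(x)$ with state $x\in\mathbb{R}^n$ and output $y\in\mathbb{R}^p$. The functions $f$ and $h$ are continuous and smooth up to the required order: for the integer $N\ge 1$ occurring in the definition of R-observability below, $h$ is $N$ times and $f$ is $N-1$ times continuously differentiable. The set $\Omega\subset\mathbb{R}^n$ of permissible initial conditions is compact (the state space $\mathbb{R}^n$ is not). For $x_0\in\Omega$ the solution with initial value $x_0$ at $t=0$ is unique and is denoted by $\varphi(t,0,x_0)$; it is a continuous function of $x_0$. Solutions are well defined on the time interval considered: there is $\tau\in(0,\infty]$ such that for every $x_0\in\Omega$ the solution $\varphi(t,0,x_0)$ is defined for all $t\in[0,\tau)$ (the forward complete case is $\tau=\infty$). Indistinguishable pair: a pair $(x_1,x_2)$ of initial states with $x_1\ne x_2$ such that $h(\varphi(t,0,x_1))=h(\varphi(t,0,x_2))$ for all $t\in[0,\tau)$ (i.e. for all $t\ge 0$ when $\tau=\infty$). D-observability with respect to $\Omega$: there is no indistinguishable pair $(x_1,x_2)$ with $x_1,x_2\in\Omega$. R-observability with respect to $\Omega$: there exists an integer $N>0$ such that the Jacobian of the map $H(x)=(h(x),L_fh(x),\ldots,L_f^{N-1}h(x))\in\mathbb{R}^{Np}$ has full rank, i.e. rank $n$, at every point $x\in\Omega$, where $L_fh=\frac{\partial h}{\partial x}f$ and $L_f^kh=L_f(L_f^{k-1}h)$. $\mathcal{K}$-function: a function $\alpha:D\to[0,\infty)$, where $D$ is $[0,\infty)$, $[0,a)$ or $[0,a]$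 with $a>0$, that is continuous, strictly increasing, and satisfies $\alpha(0)=0$. In the claim, $D$ contains all values $|x_1-x_2|$ with $x_1,x_2\in\Omega$. Here $|\cdot|$ is the Euclidean norm. *)

(* Defs.v *)
(* R^n is 'rV[R]_n (row vectors) for an arbitrary R : realType. *)
From HB Require Import structures.
From mathcomp Require Import all_boot all_order all_algebra.
From mathcomp Require Import all_classical all_reals all_analysis.

Set Implicit Arguments.
Unset Strict Implicit.
Unset Printing Implicit Defensive.

Import Order.TTheory GRing.Theory Num.Theory.
Import numFieldNormedType.Exports.

Local Open Scope classical_set_scope.
Local Open Scope ring_scope.

(* The library norm `|x| on row vectors is the sup norm; it induces the same
   topology. *)
Definition enorm (R : realType) (n : nat) (x : 'rV[R]_n) : R :=
  Num.sqrt (\sum_(i < n) x 0 i ^+ 2).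

(* Class C^k on the whole of R^n: iterated Frechet differentiability, the
   derivative being tested on every constant direction v. *)
Fixpoint cont_diff (R : realType) (n m k : nat) (g : 'rV[R]_n -> 'rV[R]_m)
    : Prop :=
  match k with
  | 0%N => continuous g
  | k'.+1 => (forall x, differentiable g x) /\
             (forall v, cont_diff k' (fun x => 'd g x v))
  end.

(* Since vectors are rows, 'J g x is the transpose of the usual Jacobian matrix,
   and (dg/dx) f reads as a product on the left; the rank is unaffected. *)
Definition lie_deriv (R : realType) (n m : nat) (f : 'rV[R]_n -> 'rV[R]_n)
    (g : 'rV[R]_n -> 'rV[R]_m) : 'rV[R]_n -> 'rV[R]_m :=
  fun x => f x *m 'J g x.

(* mxvec concatenates the N rows h, L_f h, ..., L_f^(N-1) h. *)
Definition obs_map (R : realType) (n p : nat) (f : 'rV[R]_n -> 'rV[R]_n)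
    (h : 'rV[R]_n -> 'rV[R]_p) (N : nat) : 'rV[R]_n -> 'rV[R]_(N * p) :=
  fun x => mxvec (\matrix_(k < N) iter k (lie_deriv f) h x).

Definition horizon (R : realType) (tau : \bar R) : set R :=
  [set t | 0 <= t /\ (t%:E < tau)%E].

(* The derivative is relative to [0, tau[, hence one-sided at t = 0. *)
Definition solution_on (R : realType) (n : nat) (f : 'rV[R]_n -> 'rV[R]_n)
    (tau : \bar R) (psi : R -> 'rV[R]_n) (x0 : 'rV[R]_n) : Prop :=
  psi 0 = x0 /\
  forall t, horizon tau t ->
    (s - t)^-1 *: (psi s - psi t) @[s --> within (horizon tau) t^']
      --> f (psi t).

(* phi t x0 stands for phi(t, 0, x0); its values are constrained only for x0 in
   Omega and t in [0, tau[. *)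
Definition is_flow (R : realType) (n : nat) (f : 'rV[R]_n -> 'rV[R]_n)
    (Omega : set 'rV[R]_n) (tau : \bar R) (phi : R -> 'rV[R]_n -> 'rV[R]_n)
    : Prop :=
  [/\ forall x0, Omega x0 -> solution_on f tau (phi^~ x0) x0,
      forall x0 (sigma : \bar R) psi, Omega x0 ->
        (0 < sigma <= tau)%E -> solution_on f sigma psi x0 ->
        forall t, horizon sigma t -> psi t = phi t x0
    & forall t, horizon tau t -> {within Omega, continuous (phi t)}].

Definition indistinguishable (R : realType) (n p : nat)
    (h : 'rV[R]_n -> 'rV[R]_p) (tau : \bar R)
    (phi : R -> 'rV[R]_n -> 'rV[R]_n) (x1 x2 : 'rV[R]_n) : Prop :=
  x1 <> x2 /\ forall t, horizon tau t -> h (phi t x1) = h (phi t x2).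

Definition D_observable (R : realType) (n p : nat)
    (h : 'rV[R]_n -> 'rV[R]_p) (Omega : set 'rV[R]_n) (tau : \bar R)
    (phi : R -> 'rV[R]_n -> 'rV[R]_n) : Prop :=
  ~ exists x1 x2, [/\ Omega x1, Omega x2 & indistinguishable h tau phi x1 x2].

(* The smoothness requirement depends on N, so it sits under the existential. *)
Definition R_observable (R : realType) (n p : nat)
    (f : 'rV[R]_n -> 'rV[R]_n) (h : 'rV[R]_n -> 'rV[R]_p)
    (Omega : set 'rV[R]_n) : Prop :=
  exists N : nat,
    [/\ (0 < N)%N, cont_diff N h, cont_diff N.-1 f
      & forall x, Omega x -> \rank ('J (obs_map f h N) x) = n].

Definition K_domain (R : realType) (D : set R) : Prop :=
  D = `[0, +oo[%classic \/
  exists2 a : R, 0 < a & (D = `[0, a[%classic \/ D = `[0, a]%classic).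

Definition K_function (R : realType) (D : set R) (alpha : R -> R) : Prop :=
  [/\ K_domain D,
      forall r, D r -> 0 <= alpha r,
      {within D, continuous alpha},
      forall r s, D r -> D s -> r < s -> alpha r < alpha s
    & alpha 0 = 0].

Definition K_observable (R : realType) (n p : nat)
    (h : 'rV[R]_n -> 'rV[R]_p) (Omega : set 'rV[R]_n) (tau : \bar R)
    (phi : R -> 'rV[R]_n -> 'rV[R]_n) : Prop :=
  exists T : R, [/\ 0 < T, (T%:E < tau)%E
    & exists (D : set R) (alpha : R -> R),
      [/\ K_function D alpha,
          forall x1 x2, Omega x1 -> Omega x2 -> D (enorm (x1 - x2))
        & forall x1 x2, Omega x1 -> Omega x2 ->
            (\int[lebesgue_measure]_(t in `[0%R, T])
               (enorm (h (phi t x1) - h (phi t x2)) ^+ 2)%:E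
             >= (alpha (enorm (x1 - x2)))%:E)%E]].

(* Main.v *)
Require Import Defs.
From HB Require Import structures.
From mathcomp Require Import all_boot all_order all_algebra.
From mathcomp Require Import all_classical all_reals all_analysis.
From mathcomp Require Import measurable_realfun ring lra.

Set Implicit Arguments.
Unset Strict Implicit.
Unset Printing Implicit Defensive.

Import Order.TTheory GRing.Theory Num.Theory.
Import numFieldNormedType.Exports.

Local Open Scope classical_set_scope.
Local Open Scope ring_scope.

(** The theorem is a compactness argument resting on one fact: R-observability
    forbids indistinguishable pairs near the diagonal of Omega x Omega, however
    short the observation window.  Differentiating y(t) = h (phi t x) along a
    solution k times gives the k-th Lie derivative of h, so two outputs that
    agree on some [0, T[ have the same value of the observability map at time 0
    ([output_determines_obs_map]); and that map, being C^1 with a Jacobian of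
    full rank, is injective near each point of Omega
    ([C1_locally_injective]).

    Away from the diagonal, D-observability gives each pair (a, b) a time at
    which the outputs differ, and they still differ at that time for all nearby
    pairs.  Covering the compact set Omega x Omega by these two kinds of
    neighbourhoods yields one T < tau that distinguishes all pairs at once
    ([uniform_distinguishing_time]).

    For this T, let E(x1, x2) be the integral in the statement.  It is positive
    off the diagonal, because the integrand is continuous in t.  Continuity of
    the flow in x for each fixed t does not by itself give continuity of E, but by
    Fatou's lemma E is lower semicontinuous ([lower_semicontinuous_integral]),
    which is enough to bound it below by a positive constant on the pairs at
    distance at least r, for each r > 0 ([output_energy_bounded_below]).

    It remains to turn these constants into a K-function.  The infimum over all
    pairs of min(E, 1) + max(0, r - |x1 - x2|) is nondecreasing and 1-Lipschitz
    in r, positive for r > 0, and at most E at r = |x1 - x2|; multiplying it by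
    r / (1 + r) makes it strictly increasing and zero at 0
    ([K_function_minorant]). *)

(** * Calculus of C^k maps *)

Lemma cont_diff_le1 (R : realType) (n m k : nat) (g : 'rV[R]_n -> 'rV[R]_m) :
  cont_diff k.+1 g -> cont_diff k g.
Proof.
elim: k g => [|k IH] g.
  by move=> [dg _] x; exact/differentiable_continuous.
by move=> [dg cdg]; split=> // v; exact/IH.
Qed.

Lemma cont_diff_le (R : realType) (n m k l : nat)
    (g : 'rV[R]_n -> 'rV[R]_m) :
  (k <= l)%N -> cont_diff l g -> cont_diff k g.
Proof.
move=> /subnKC <-; elim: (l - k)%N => [|j IH]; first by rewrite addn0.
by rewrite addnS => /cont_diff_le1.
Qed.

Lemma cont_diff_cst (R : realType) (n m k : nat) (c : 'rV[R]_m) :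
  cont_diff k (cst c : 'rV[R]_n -> 'rV[R]_m).
Proof.
elim: k c => [|k IH] c; first exact: cst_continuous.
split=> [x|v]; first exact: differentiable_cst.
rewrite (_ : (fun x => _) = cst 0) //.
by apply/funext => x; rewrite diff_cst.
Qed.

Lemma cont_diffD (R : realType) (n m k : nat) (f g : 'rV[R]_n -> 'rV[R]_m) :
  cont_diff k f -> cont_diff k g -> cont_diff k (fun x => f x + g x).
Proof.
elim: k f g => [|k IH] f g.
  by move=> cf cg x; apply: (cvgD (cf x) (cg x)).
move=> [df cdf] [dg cdg]; split=> [x|v]; first exact: differentiableD.
rewrite (_ : (fun x => _) = (fun x => 'd f x v + 'd g x v)).
  exact: IH (cdf v) (cdg v).
by apply/funext => x; exact: (congr1 (@^~ v) (diffD (df x) (dg x))).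
Qed.

Lemma cont_diff_sum (R : realType) (n m k : nat) (I : Type) (r : seq I)
    (F : I -> 'rV[R]_n -> 'rV[R]_m) :
  (forall i, cont_diff k (F i)) -> cont_diff k (fun x => \sum_(i <- r) F i x).
Proof.
move=> cF; elim: r => [|i r IH].
  rewrite (_ : (fun x => _) = cst 0); first exact: cont_diff_cst.
  by apply/funext => x; rewrite big_nil.
under eq_fun do rewrite big_cons.
exact: cont_diffD.
Qed.

(** The derivative rule for bilinear maps then gives the product rule for a
    scalar function times a vector function. *)
Lemma scaler_is_bilinear (R : realType) (m : nat) :
  bilinear_for (GRing.Scale.Law.clone _ _ *:%R _)
    (GRing.Scale.Law.clone _ _ *:%R _) (@GRing.scale R 'rV[R]_m).
Proof.
split=> [u'|u] a x y /=; first by rewrite scalerDl scalerA.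
by rewrite scalerDr !scalerA mulrC.
Qed.

HB.instance Definition _ (R : realType) (m : nat) :=
  bilinear_isBilinear.Build R R 'rV[R]_m 'rV[R]_m _ _ (@GRing.scale R 'rV[R]_m)
    (@scaler_is_bilinear R m).

Lemma is_diff_scaler_pair (R : realType) (m : nat) (p : R * 'rV[R]_m) :
  is_diff p (fun q : R * 'rV[R]_m => q.1 *: q.2)
    (fun q => p.1 *: q.2 + q.1 *: p.2).
Proof.
have sc : continuous (fun q : R * 'rV[R]_m => q.1 *: q.2).
  by move=> q; apply: scale_continuous.
apply: DiffDef; last by rewrite diff_bilin.
exact: differentiable_bilin.
Qed.

Lemma is_diff_coord (R : realType) (n m : nat) (f : 'rV[R]_n -> 'rV[R]_m)
    (x : 'rV[R]_n) (i : 'I_m) :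
  differentiable f x ->
  is_diff x (fun y => f y 0 i) (fun v => 'd f x v 0 i).
Proof.
move=> df.
pose c := (fun N : 'rV[R]_m => N 0 i).
have clin : linear c by move=> a u v; rewrite /c !mxE.
pose cM := GRing.isLinear.Build _ _ _ _ _ clin.
pose cL : {linear _ -> _} := HB.pack c cM.
have dc y : is_diff y c c.
  apply: DiffDef; first exact: differentiable_coord.
  by apply: (@diff_lin _ _ _ cL); exact: coord_continuous.
have dfx := differentiableP df.
exact: (is_diff_comp dfx (dc _)).
Qed.

Lemma is_diff_coordZ (R : realType) (n m q : nat) (f : 'rV[R]_n -> 'rV[R]_q)
    (w : 'rV[R]_n -> 'rV[R]_m) (i : 'I_q) (x : 'rV[R]_n) :
  differentiable f x -> differentiable w x ->
  is_diff x (fun y => f y 0 i *: w y)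
    (fun v => f x 0 i *: 'd w x v + 'd f x v 0 i *: w x).
Proof.
move=> df dw.
have dp := is_diff_pair (is_diff_coord i df) (differentiableP dw).
exact: (is_diff_comp dp (is_diff_scaler_pair (f x 0 i, w x))).
Qed.

(** Every construction below (right multiplication by a matrix, Lie derivative,
    observability map) is a finite sum of products of a coordinate of one map by
    another map, so this is the only product rule that C^k calculus needs here. *)
Lemma cont_diff_coordZ (R : realType) (n m q k : nat)
    (f : 'rV[R]_n -> 'rV[R]_q) (w : 'rV[R]_n -> 'rV[R]_m) (i : 'I_q) :
  cont_diff k f -> cont_diff k w -> cont_diff k (fun x => f x 0 i *: w x).
Proof.
elim: k f w => [|k IH] f w.
  move=> cf cw x; apply: continuousZ; last exact: cw.
  by apply: (@continuous_comp _ _ _ f (fun N : 'rV[R]_q => N 0 i));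
    [exact: cf | exact: coord_continuous].
move=> Cf Cw; have [[df cdf] [dw cdw]] := (Cf, Cw); split=> [x|v].
  by have [] := is_diff_coordZ i (df x) (dw x).
rewrite (_ : (fun x => _) =
  (fun x => f x 0 i *: 'd w x v + 'd f x v 0 i *: w x)); last first.
  apply/funext => x; have [_ E] := is_diff_coordZ i (df x) (dw x).
  exact: (congr1 (@^~ v) E).
apply: cont_diffD; first exact: IH (cont_diff_le1 Cf) (cdw v).
exact: IH (cdf v) (cont_diff_le1 Cw).
Qed.

Lemma cont_diff_mulmxr (R : realType) (n m q k : nat)
    (f : 'rV[R]_n -> 'rV[R]_q) (M : 'M[R]_(q, m)) :
  cont_diff k f -> cont_diff k (fun x => f x *m M).
Proof.
move=> cf; under eq_fun do rewrite mulmx_sum_row.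
apply: cont_diff_sum => i; apply: cont_diff_coordZ => //; exact: cont_diff_cst.
Qed.

(** L_f g is the sum over i of f_i times the partial derivative of g along the
    i-th basis vector, and these partial derivatives are C^k by definition. *)
Lemma cont_diff_lie_deriv (R : realType) (n m k : nat)
    (f : 'rV[R]_n -> 'rV[R]_n) (g : 'rV[R]_n -> 'rV[R]_m) :
  cont_diff k f -> cont_diff k.+1 g -> cont_diff k (lie_deriv f g).
Proof.
move=> cf [_ cdg]; rewrite /lie_deriv.
under eq_fun do rewrite mulmx_sum_row.
apply: cont_diff_sum => i; apply: cont_diff_coordZ => //.
under eq_fun do rewrite rowE mul_rV_lin1.
exact: cdg.
Qed.

Lemma cont_diff_iter_lie (R : realType) (n p N k : nat)
    (f : 'rV[R]_n -> 'rV[R]_n) (h : 'rV[R]_n -> 'rV[R]_p) :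
  cont_diff N.-1 f -> cont_diff N h -> (k <= N)%N ->
  cont_diff (N - k) (iter k (lie_deriv f) h).
Proof.
move=> cf ch; elim: k => [|k IH] kN; first by rewrite subn0.
have Nk : (N - k = (N - k.+1).+1)%N by rewrite subnS prednK // subn_gt0.
apply: cont_diff_lie_deriv; last by rewrite -Nk; exact/IH/ltnW.
by apply: cont_diff_le cf; rewrite subnS -!subn1 leq_sub2r // leq_subr.
Qed.

Lemma cont_diff_obs_map (R : realType) (n p N : nat)
    (f : 'rV[R]_n -> 'rV[R]_n) (h : 'rV[R]_n -> 'rV[R]_p) :
  cont_diff N.-1 f -> cont_diff N h -> cont_diff 1 (obs_map f h N).
Proof.
move=> cf ch.
(* The k-th block enters the concatenation through a fixed linear map. *)
have E : obs_map f h N = fun x => \sum_(k < N) iter k (lie_deriv f) h x *m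
    lin1_mx (mxvec \o mulmx (delta_mx k (0 : 'I_1))).
  apply/funext => x; rewrite /obs_map.
  under eq_bigr => k _ do rewrite mul_rV_lin1 /=.
  rewrite -linear_sum; congr mxvec; apply/row_matrixP => k.
  apply/rowP => j; rewrite rowK mxE summxE (bigD1 k) //= big1 => [|l lk].
    by rewrite addr0 mxE big_ord1 mxE !eqxx mul1r.
  by rewrite mxE big_ord1 mxE eq_sym (negbTE lk) mul0r.
rewrite E; apply: cont_diff_sum => k; apply: cont_diff_mulmxr.
apply: cont_diff_le (cont_diff_iter_lie cf ch (ltnW _)) => //.
by rewrite subn_gt0.
Qed.

(** * Local injectivity of C^1 immersions *)

Lemma rV_normr_le (R : realType) (m : nat) (x : 'rV[R]_m) (c : R) :
  0 <= c -> (forall i, `|x 0 i| <= c) -> `|x| <= c.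
Proof.
move=> c0 H; rewrite /Num.Def.normr /= mx_normrE.
rewrite (bigmax_le _ c0) //= => -[i j] _.
by rewrite ord1.
Qed.

Lemma rV_coord_le (R : realType) (m : nat) (x : 'rV[R]_m) i : `|x 0 i| <= `|x|.
Proof.
rewrite [leRHS]/Num.Def.normr /= mx_normrE.
exact: (le_bigmax _ (fun ij : 'I_1 * 'I_m => `|x ij.1 ij.2|) (0, i)).
Qed.

(** The mean value theorem fails for vector-valued maps: the intermediate point
    has to depend on the coordinate. *)
Lemma mean_value_coord (R : realType) (n m : nat) (g : 'rV[R]_n -> 'rV[R]_m)
    (x y : 'rV[R]_n) (i : 'I_m) :
  (forall z, differentiable g z) ->
  exists2 c, 0 <= c <= 1 &
    (g x - g y) 0 i = 'd g (y + c *: (x - y)) (x - y) 0 i.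
Proof.
move=> dg; set v := x - y.
have dl (t : R) : is_diff t (fun s => y + s *: v) ( *:%R^~ v).
  by have := is_diffD (is_diff_cst y t) (is_diff_scalel t v); rewrite add0r.
have dF (t : R) : is_diff t (fun s => g (y + s *: v) 0 i)
    (fun s => 'd g (y + t *: v) (s *: v) 0 i).
  have d1 := is_diff_coord i (dg (y + t *: v)).
  exact: (is_diff_comp (dl t) d1).
have dF1 (t : R) : is_derive t 1 (fun s => g (y + s *: v) 0 i)
    ('d g (y + t *: v) v 0 i).
  have [d1 d2] := dF t; apply: DeriveDef; first exact: diff_derivable.
  by rewrite deriveE // d2 scale1r.
have [|c c01 E] := MVT_segment ler01 (fun t _ => dF1 t).
  apply: continuous_subspaceT => t; apply: differentiable_continuous.
  by have [] := dF t.
exists c; first by move: c01; rewrite in_itv.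
move: E; rewrite scale1r scale0r addr0 subr0 mulr1.
by rewrite {1}/v [y + _]addrC subrK => <-; rewrite !mxE.
Qed.

Lemma diff_sum_delta (R : realType) (n m : nat) (g : 'rV[R]_n -> 'rV[R]_m)
    (x v : 'rV[R]_n) :
  'd g x v = \sum_(j < n) v 0 j *: 'd g x (delta_mx 0 j).
Proof.
rewrite -mul_rV_lin1 mulmx_sum_row; apply: eq_bigr => j _.
by rewrite rowE mul_rV_lin1.
Qed.

(** For a C^1 map the linear approximation error is uniformly small on pairs of
    points near a, not only on pairs containing a.  By the mean value theorem the
    error in each coordinate is a value of 'd g z - 'd g a with z on the segment,
    and it suffices to control this difference on the finitely many basis
    vectors. *)
Lemma strict_differentiability (R : realType) (n m : nat)
    (g : 'rV[R]_n -> 'rV[R]_m) (a : 'rV[R]_n) (e : R) :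
  cont_diff 1 g -> 0 < e ->
  exists2 r, 0 < r & forall x y, ball a r x -> ball a r y ->
    `|g x - g y - 'd g a (x - y)| <= e * `|x - y|.
Proof.
move=> [dg cdg] e0.
(* n.+1 rather than n keeps the divisor positive in dimension 0. *)
have d0 : 0 < e / n.+1%:R by rewrite divr_gt0.
have : \forall z \near a, forall j : 'I_n,
    `|'d g a (delta_mx 0 j) - 'd g z (delta_mx 0 j)| <= e / n.+1%:R.
  apply: (@filter_forall _ _ (fun (j : 'I_n) z =>
    `|'d g a (delta_mx 0 j) - 'd g z (delta_mx 0 j)| <= e / n.+1%:R)
    (nbhs a) _) => j.
  have c := cdg (delta_mx 0 j) a.
  by have /cvgrPdist_le/(_ _ d0) :
      'd g z (delta_mx 0 j) @[z --> a] --> 'd g a (delta_mx 0 j) := c.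
move=> /nbhs_ballP[r /= r0 Hr]; exists r => // x y ax ay.
apply: rV_normr_le => [|i]; first by rewrite mulr_ge0 // ltW.
have [c /andP[c0 c1] E] := mean_value_coord x y i dg.
set z := y + c *: (x - y) in E.
have az : ball a r z.
  move: ax ay; rewrite -!ball_normE /= => ax ay.
  have -> : a - z = c *: (a - x) + (1 - c) *: (a - y).
    by apply/rowP => j; rewrite !mxE; ring.
  set M := Num.max `|a - x| `|a - y|.
  have Mr : M < r by rewrite gt_max ax ay.
  apply: le_lt_trans Mr; apply: le_trans (ler_normD _ _) _.
  rewrite !normrZ (ger0_norm c0) ger0_norm ?subr_ge0 //.
  have -> : M = c * M + (1 - c) * M by ring.
  by rewrite lerD // ler_wpM2l ?subr_ge0 // le_max lexx ?orbT.
have -> : (g x - g y - 'd g a (x - y)) 0 i =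
    ('d g z (x - y) - 'd g a (x - y)) 0 i.
  by rewrite mxE E [RHS]mxE.
apply: le_trans (rV_coord_le _ _) _; set v := x - y.
have -> : 'd g z v - 'd g a v =
    \sum_(j < n) v 0 j *: ('d g z (delta_mx 0 j) - 'd g a (delta_mx 0 j)).
  apply: (etrans (congr2 (fun p q => p - q)
    (diff_sum_delta g z v) (diff_sum_delta g a v))).
  by rewrite -sumrB; apply: eq_bigr => j _; rewrite scalerBr.
apply: le_trans (ler_norm_sum _ _ _) _.
apply: (@le_trans _ _ (\sum_(j < n) `|v| * (e / n.+1%:R))).
  apply: ler_sum => j _; rewrite normrZ ler_pM ?rV_coord_le //.
  by rewrite distrC; exact: Hr.
rewrite sumr_const card_ord -[leLHS]mulr_natr.
have -> : `|v| * (e / n.+1%:R) * n%:R = e * `|v| * (n%:R / n.+1%:R) by ring.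
rewrite -[leRHS]mulr1 ler_wpM2l ?mulr_ge0 ?(ltW e0) //.
by rewrite ler_pdivrMr ?mul1r ?ler_nat.
Qed.

(** Full rank gives the derivative J at a a right inverse B, with operator norm at
    most k.  If H x = H y near a, strict differentiability bounds (x - y) J by
    |x - y| / (2 k), and applying B gives |x - y| <= |x - y| / 2. *)
Lemma C1_locally_injective (R : realType) (n m : nat)
    (H : 'rV[R]_n -> 'rV[R]_m) (a : 'rV[R]_n) :
  cont_diff 1 H -> \rank ('J H a) = n ->
  exists2 r, 0 < r & forall x y, ball a r x -> ball a r y -> H x = H y -> x = y.
Proof.
move=> cH rk; set J := 'J H a; set B := pinvmx J.
have JB : J *m B = 1%:M by apply: mulmxVp; rewrite /row_free rk.
have cB : continuous (mulmxr B : 'rV[R]_m -> 'rV[R]_n).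
  by apply: (@cont_diff_mulmxr _ _ _ _ 0 id B) => x; exact: cvg_id.
have [k k0 Hk] := linear_lipschitz cB.
have [|r r0 Hr] := strict_differentiability (e := (2 * k)^-1) a cH.
  by rewrite invr_gt0 mulr_gt0.
exists r => // x y ax ay Hxy; apply/eqP; rewrite -subr_eq0 -normr_le0.
move: (Hr _ _ ax ay); rewrite Hxy subrr sub0r normrN => Hle.
have E : 'd H a (x - y) *m B = x - y.
  have -> : 'd H a (x - y) = (x - y) *m J by rewrite mul_rV_lin1.
  by rewrite -mulmxA JB mulmx1.
have := Hk ('d H a (x - y)); rewrite /= E => Hk1.
have {}Hle := le_trans Hk1 (ler_wpM2l (ltW k0) Hle).
suff : `|x - y| <= 2^-1 * `|x - y| by lra.
by apply: le_trans Hle _; rewrite mulrA invfM mulrCA mulfV ?mulr1 ?gt_eqF.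
Qed.

(** * Derivatives of outputs along solutions *)

Lemma cvg_of_diff_quotient (R : realType) (n : nat) (F : set_system R)
    (FF : Filter F) (t : R) (psi : R -> 'rV[R]_n) (w : 'rV[R]_n) :
  F `=>` t^' -> (s - t)^-1 *: (psi s - psi t) @[s --> F] --> w ->
  psi s @[s --> F] --> psi t.
Proof.
move=> Ft qw.
have s_neq : \forall s \near F, s != t by apply: Ft; exact: withinT.
have s_cvg : s @[s --> F] --> t.
  by move=> A At; apply: Ft; exact: nbhs_dnbhs.
have : psi t + (s - t) *: ((s - t)^-1 *: (psi s - psi t)) @[s --> F] -->
    psi t + (t - t) *: w.
  apply: cvgD; first exact: cvg_cst.
  by apply: cvgZ => //; apply: cvgB => //; exact: cvg_cst.
rewrite subrr scale0r addr0; apply: cvg_trans; apply: near_eq_cvg.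
near=> s; rewrite scalerA mulfV ?scale1r ?subr_eq0; last by near: s.
by rewrite addrC subrK.
Unshelve. all: by end_near. Qed.

Lemma solution_continuous (R : realType) (n : nat)
    (f : 'rV[R]_n -> 'rV[R]_n) (tau : \bar R) (psi : R -> 'rV[R]_n)
    (x0 : 'rV[R]_n) :
  solution_on f tau psi x0 -> {within horizon tau, continuous psi}.
Proof.
move=> [_ sol]; apply/subspace_continuousP => t tH U Ut.
have wt : within (horizon tau) t^' `=>` t^' by exact: cvg_within.
have W : nbhs t (fun s => s != t -> horizon tau s -> U (psi s)).
  exact: (cvg_of_diff_quotient _ wt (sol t tH) Ut).
apply: (@filterS _ (nbhs t) _ _ _ _ W) => s HU sH.
by have [->|st] := eqVneq s t; [exact: (nbhs_singleton Ut) | exact: HU].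
Qed.

(** Solutions are differentiable only relative to the horizon, one-sidedly at 0;
    stating the chain rule along an arbitrary filter of times s <> t covers this. *)
Lemma chain_rule_along (R : realType) (n m : nat) (F : set_system R)
    (FF : Filter F) (t : R) (psi : R -> 'rV[R]_n) (w : 'rV[R]_n)
    (g : 'rV[R]_n -> 'rV[R]_m) :
  F `=>` t^' -> cont_diff 1 g ->
  (s - t)^-1 *: (psi s - psi t) @[s --> F] --> w ->
  (s - t)^-1 *: (g (psi s) - g (psi t)) @[s --> F] --> 'd g (psi t) w.
Proof.
move=> Ft cg qw; have [dg _] := cg.
set q := (fun s => (s - t)^-1 *: (psi s - psi t)) in qw *.
have psi_cvg := cvg_of_diff_quotient FF Ft qw.
have dq_cvg : 'd g (psi t) (q s) @[s --> F] --> 'd g (psi t) w.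
  apply: (@cvg_comp _ _ _ q ('d g (psi t)) F (nbhs w)) => //.
  exact: (diff_continuous (dg (psi t))).
rewrite -[X in _ --> X]addr0.
(* The difference quotient of g along psi is 'd g applied to that of psi, plus
   the linearization error r, which strict differentiability makes vanish. *)
pose r s :=
  (s - t)^-1 *: (g (psi s) - g (psi t) - 'd g (psi t) (psi s - psi t)).
have -> : (fun s => (s - t)^-1 *: (g (psi s) - g (psi t))) =
    (fun s => 'd g (psi t) (q s) + r s).
  apply/funext => s; rewrite /r /q linearZ /= -scalerDr.
  by congr (_ *: _); rewrite [RHS]addrC subrK.
apply: cvgD => //; apply/cvgr0Pnorm_le => e e0.
have d0 : 0 < e / (`|w| + 1) by rewrite divr_gt0 // ltr_wpDl.
have [rho rho0 Hrho] := strict_differentiability (psi t) cg d0.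
have qbound : \forall s \near F, `|q s| <= `|w| + 1.
  move/cvgrPdist_le : qw => /(_ _ ltr01); apply: filterS => s ws.
  have -> : q s = w - (w - q s) by rewrite opprB addrC subrK.
  by apply: le_trans (ler_normB _ _) _; rewrite lerD2l.
have psi_ball : \forall s \near F, ball (psi t) rho (psi s).
  by apply: psi_cvg; exact: nbhsx_ballx.
near=> s.
have qs : `|q s| <= `|w| + 1 by near: s.
have ps : ball (psi t) rho (psi s) by near: s.
rewrite /r normrZ.
have /(ler_wpM2l (normr_ge0 (s - t)^-1)) := Hrho _ _ ps (ballxx _ rho0).
move=> /le_trans; apply.
rewrite mulrCA -normrZ -/(q s).
apply: (@le_trans _ _ (e / (`|w| + 1) * (`|w| + 1))).
  by rewrite ler_wpM2l // ltW.
by rewrite divfK // gt_eqF // ltr_wpDl.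
Unshelve. all: by end_near. Qed.

Lemma at_right_dnbhs (R : realType) (t : R) : t^'+ `=>` t^'.
Proof.
move=> A; apply: (@filterS _ (nbhs t)) => s sA ts.
by apply: sA; rewrite gt_eqF.
Qed.

Lemma EFin_lt_between (R : realType) (t : R) (tau : \bar R) :
  (t%:E < tau)%E -> exists2 T, t < T & (T%:E < tau)%E.
Proof.
case: tau => [r|_|//]; last by exists (t + 1); rewrite ?ltry ?ltrDl.
rewrite lte_fin => tr; exists ((t + r) / 2); rewrite ?lte_fin; lra.
Qed.

Lemma at_right_horizon (R : realType) (tau : \bar R) (t : R) :
  horizon tau t -> t^'+ `=>` within (horizon tau) t^'.
Proof.
move=> [t0 tT] A /= AH.
have [T tltT Ttau] : exists2 T, t < T & (T%:E < tau)%E.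
  exact: EFin_lt_between.
near=> s.
have ts : t < s by near: s; exact: nbhs_right_gt.
have sT : s < T by near: s; exact: nbhs_right_lt.
have : horizon tau s -> A s by near: s; exact: (at_right_dnbhs AH).
apply.
by split; [exact/ltW/(le_lt_trans t0)|apply: lt_trans Ttau; rewrite lte_fin].
Unshelve. all: by end_near. Qed.

(** Right difference quotients at t < T are enough: their limits are the Lie
    derivatives, and they only see times at which the two functions agree. *)
Lemma lie_deriv_eq (R : realType) (n p : nat) (f : 'rV[R]_n -> 'rV[R]_n)
    (g : 'rV[R]_n -> 'rV[R]_p) (tau : \bar R) (T : R)
    (psi1 psi2 : R -> 'rV[R]_n) (x1 x2 : 'rV[R]_n) :
  (T%:E < tau)%E -> cont_diff 1 g ->
  solution_on f tau psi1 x1 -> solution_on f tau psi2 x2 ->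
  (forall t, 0 <= t < T -> g (psi1 t) = g (psi2 t)) ->
  forall t, 0 <= t < T ->
    lie_deriv f g (psi1 t) = lie_deriv f g (psi2 t).
Proof.
move=> Ttau cg [_ sol1] [_ sol2] Eg t /andP[t0 tT].
have tH : horizon tau t by split => //; apply: lt_trans Ttau; rewrite lte_fin.
have lim (psi : R -> 'rV[R]_n) : (forall s, horizon tau s ->
    (r - s)^-1 *: (psi r - psi s) @[r --> within (horizon tau) s^']
      --> f (psi s)) ->
    (s - t)^-1 *: (g (psi s) - g (psi t)) @[s --> t^'+] -->
    lie_deriv f g (psi t).
  move=> sol; rewrite /lie_deriv mul_rV_lin1; apply: chain_rule_along => //.
    exact: at_right_dnbhs.
  by apply: cvg_trans (sol _ tH); apply: cvg_app; exact: at_right_horizon.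
have l1 := lim _ sol1; have l2 := lim _ sol2.
apply: (cvg_unique _ l1); first exact: norm_hausdorff.
apply: cvg_trans l2; apply: near_eq_cvg; near=> s.
rewrite -!Eg ?t0 //; apply/andP; split; last by near: s; exact: nbhs_right_lt.
by apply: le_trans t0 _; apply/ltW; near: s; exact: nbhs_right_gt.
Unshelve. all: by end_near. Qed.

(** Each differentiation along the flow turns agreement of the k-th Lie
    derivatives on [0, T[ into agreement of the next ones. *)
Lemma output_determines_obs_map (R : realType) (n p N : nat)
    (f : 'rV[R]_n -> 'rV[R]_n) (h : 'rV[R]_n -> 'rV[R]_p) (tau : \bar R)
    (T : R) (psi1 psi2 : R -> 'rV[R]_n) (x1 x2 : 'rV[R]_n) :
  0 < T -> (T%:E < tau)%E -> cont_diff N.-1 f -> cont_diff N h ->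
  solution_on f tau psi1 x1 -> solution_on f tau psi2 x2 ->
  (forall t, 0 <= t < T -> h (psi1 t) = h (psi2 t)) ->
  obs_map f h N x1 = obs_map f h N x2.
Proof.
move=> T0 Ttau cf ch sol1 sol2 Eh.
have E k : (k < N)%N -> forall t, 0 <= t < T ->
    iter k (lie_deriv f) h (psi1 t) = iter k (lie_deriv f) h (psi2 t).
  elim: k => [_|k IH kN]; first exact: Eh.
  apply: (lie_deriv_eq Ttau _ sol1 sol2 (IH (ltnW kN))).
  by apply: cont_diff_le (cont_diff_iter_lie cf ch (ltnW (ltnW kN)));
    rewrite subn_gt0 ltnW.
rewrite /obs_map; congr mxvec; apply/row_matrixP => k; rewrite !rowK.
have [<- _] := sol1; have [<- _] := sol2.
by apply: E; rewrite // lexx.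
Qed.

(** * A common observation time *)

Lemma distinguishing_nbhs (R : realType) (n p : nat) (Omega : set 'rV[R]_n)
    (g : 'rV[R]_n -> 'rV[R]_p) (a b : 'rV[R]_n) :
  {within Omega, continuous g} -> Omega a -> Omega b -> g a <> g b ->
  \forall xy \near (a, b), (Omega `*` Omega) xy -> g xy.1 <> g xy.2.
Proof.
move=> /subspace_continuousP cg aO bO gab.
set d := `|g a - g b| / 2.
have d0 : 0 < d by rewrite divr_gt0 // normr_gt0 subr_eq0; apply/eqP.
have near_g x : Omega x -> \forall y \near x, Omega y -> `|g x - g y| < d.
  by move=> xO; have /cvgrPdist_lt/(_ _ d0) := cg x xO.
exists ([set x | Omega x -> `|g a - g x| < d],
        [set x | Omega x -> `|g b - g x| < d]); first by split; exact: near_g.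
move=> [x y] /= [ax by_] [xO yO] gxy.
have := ler_distD (g x) (g a) (g b).
move: (ax xO) (by_ yO); rewrite -gxy (distrC (g b)) /d; lra.
Qed.

(** Around a diagonal pair any positive time works, by local injectivity of the
    observability map; around another pair (a, b), any time past one at which the
    outputs of a and b differ.  Compactness selects one time for all pairs. *)
Lemma uniform_distinguishing_time (R : realType) (n p N : nat)
    (f : 'rV[R]_n -> 'rV[R]_n) (h : 'rV[R]_n -> 'rV[R]_p)
    (Omega : set 'rV[R]_n) (tau : \bar R) (phi : R -> 'rV[R]_n -> 'rV[R]_n) :
  continuous h -> compact Omega -> (0 < tau)%E -> is_flow f Omega tau phi ->
  D_observable h Omega tau phi -> cont_diff N h -> cont_diff N.-1 f ->
  (forall x, Omega x -> \rank ('J (obs_map f h N) x) = n) ->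
  exists T : R, [/\ 0 < T, (T%:E < tau)%E & forall x1 x2,
    Omega x1 -> Omega x2 ->
    (forall t, 0 <= t <= T -> h (phi t x1) = h (phi t x2)) -> x1 = x2].
Proof.
move=> ch cO tau0 [sol _ cphi] Dobs Ch Cf rk.
pose D : set R := [set t | 0 < t /\ (t%:E < tau)%E].
pose tail (t : R) : set R := [set s | t <= s /\ (s%:E < tau)%E].
have [t1 t10 t1tau] := EFin_lt_between tau0.
have Dt1 : D t1 by [].
(* F is the filter of times tending to tau from below, for finite or infinite
   tau. *)
pose F := filter_from D tail.
have FF : Filter F.
  apply: filter_from_filter; first by exists t1.
  move=> s t [s0 stau] [t0 ttau]; exists (Num.max s t).
    by split; [rewrite lt_max s0 | case: (leP s t)].
  by move=> u [+ utau]; rewrite ge_max => /andP[su tu].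
pose P (T : R) (xy : 'rV[R]_n * 'rV[R]_n) :=
  (forall t, 0 <= t <= T -> h (phi t xy.1) = h (phi t xy.2)) -> xy.1 = xy.2.
have [] : F [set T | Omega `*` Omega `<=` P T].
  have /compact_near_coveringP/near_covering_withinP cover := compact_setX cO cO.
  apply: (cover R F P FF) => -[a b] [/= aO bO].
  have [<-{b bO}|/eqP ab] := eqVneq a b.
    have [r r0 Hr] := C1_locally_injective (cont_diff_obs_map Cf Ch) (rk _ aO).
    exists ([set xy | ball a r xy.1 /\ ball a r xy.2], tail t1).
      split; last by exists t1.
      exists (ball a r, ball a r); first by split; exact: nbhsx_ballx.
      by move=> [x y].
    move=> [[x y] T] /= [[ax ay] [t1T Ttau]] [xO yO] Exy; apply: Hr => //.
    apply: (output_determines_obs_map (lt_le_trans t10 t1T) Ttau Cf Ch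
      (sol _ xO) (sol _ yO)).
    by move=> t /andP[t0 tT]; apply: Exy; rewrite t0 ltW.
  have [t0 t0H ht0] : exists2 t, horizon tau t & h (phi t a) <> h (phi t b).
    apply: contrapT => nex; apply: Dobs; exists a, b; split=> //; split=> //.
    by move=> t tH; apply: contrapT => hab; apply: nex; exists t.
  have cht0 : {within Omega, continuous (h \o phi t0)}.
    have /subspace_continuousP cp := cphi _ t0H.
    apply/subspace_continuousP => x xO.
    exact: (cvg_comp (phi t0) h (cp x xO) (ch _)).
  exists ([set xy | (Omega `*` Omega) xy ->
      h (phi t0 xy.1) <> h (phi t0 xy.2)], tail (Num.max t0 t1)).
    split; first exact: (distinguishing_nbhs cht0).
    exists (Num.max t0 t1) => //; split; first by rewrite lt_max t10 orbT.
    by case: t0H => _; case: (leP t0 t1).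
  move=> [[x y] T] /= [Hxy [t01T Ttau]] [xO yO] Exy; case: (Hxy _) => //.
  apply: Exy; have [-> _] := t0H.
  by move: t01T; rewrite ge_max => /andP[].
move=> T [T0 Ttau] HT; exists T; split=> // x1 x2 x1O x2O.
exact: (HT T _ (x1, x2)).
Qed.

(** * Lower semicontinuity and positivity of integrals *)

Lemma enorm_ge0 (R : realType) (n : nat) (x : 'rV[R]_n) : 0 <= enorm x.
Proof. exact: sqrtr_ge0. Qed.

Lemma enorm_eq0 (R : realType) (n : nat) (x : 'rV[R]_n) :
  enorm x = 0 -> x = 0.
Proof.
move=> /eqP; rewrite sqrtr_eq0 => x0; apply/rowP => i; rewrite mxE.
apply/eqP; rewrite -sqrf_eq0 eq_le sqr_ge0 andbT; apply: le_trans x0.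
by rewrite (bigD1 i) //= lerDl sumr_ge0 // => j _; rewrite sqr_ge0.
Qed.

Lemma enorm_continuous (R : realType) (n : nat) :
  continuous (@enorm R n).
Proof.
move=> x; apply: (@cvg_comp _ _ _ (fun y : 'rV[R]_n => \sum_i y 0 i ^+ 2)
  Num.sqrt (nbhs x) (nbhs (\sum_i x 0 i ^+ 2))); last exact: sqrt_continuous.
apply: cvg_big => [|i _]; first by move=> p; exact: add_continuous.
have cx := @coord_continuous R 1 n 0 i x.
by rewrite expr2; under eq_fun do rewrite expr2; exact: cvgM.
Qed.

(** If the integral stayed at most c at points accumulating at x, Fatou's lemma
    along a sequence of such points would bound the integral at x by c.  Continuity
    in the parameter is needed only for each t separately. *)
Lemma lower_semicontinuous_integral (R : realType) (d : measure_display)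
    (T : measurableType d) (mu : {measure set T -> \bar R}) (D : set T)
    (X : pseudoMetricType R) (K : set X) (u : X -> T -> R) (x : X) (c : R) :
  measurable D -> (forall y, K y -> measurable_fun D (u y)) ->
  (forall y t, 0 <= u y t) ->
  (forall t, D t -> u y t @[y --> within K (nbhs x)] --> u x t) ->
  (c%:E < \int[mu]_(t in D) (u x t)%:E)%E ->
  \forall y \near x, K y -> (c%:E < \int[mu]_(t in D) (u y t)%:E)%E.
Proof.
move=> mD mu_ u0 cu cux; apply: contrapT => nnear.
have bad (k : nat) : exists y,
    [/\ ball x k.+1%:R^-1 y, K y & (\int[mu]_(t in D) (u y t)%:E <= c%:E)%E].
  apply: contrapT => nex; apply: nnear; apply/nbhs_ballP.
  exists k.+1%:R^-1; first by rewrite /= invr_gt0.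
  move=> y xy Ky; rewrite ltNge; apply/negP => yc; apply: nex.
  by exists y.
have [y Hy] := choice bad.
have y_cvg : y k @[k --> \oo] --> within K (nbhs x).
  move=> A /= /nbhs_ballP[e /= e0 He].
  suff : \forall k \near \oo, A (y k) by [].
  near=> k; have [xy Ky _] := Hy k; apply: He => //.
  apply: le_ball xy; apply/ltW; near: k; exact: near_infty_natSinv_lt (PosNum e0).
have : (\int[mu]_(t in D) limn_einf (fun k => (u (y k) t)%:E) <= c%:E)%E.
  apply: le_trans (fatou _ mD _ _) _.
  - by move=> k; apply/measurable_EFinP/mu_; have [] := Hy k.
  - by move=> k t _; rewrite lee_fin.
  rewrite limn_einf_lim; apply: lime_le; first exact: is_cvg_einfs.
  apply: nearW => k; have [_ _] := Hy k; apply: le_trans.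
  by apply: ereal_inf_lbound; exists k => /=.
apply/negP; rewrite -ltNge; apply: lt_le_trans cux _.
rewrite le_eqVlt; apply/orP; left; apply/eqP/eq_integral => t /[!inE] tD.
suff /cvg_limn_einf_sup[-> _] : (u (y k) t)%:E @[k --> \oo] --> (u x t)%:E by [].
apply: cvg_EFin; first by near=> k.
exact: cvg_comp y_cvg (cu t tD).
Unshelve. all: by end_near. Qed.

(** By continuity u exceeds half its value at t0 on a nondegenerate interval; the
    truncation to [0, T] keeps it nondegenerate when t0 is an endpoint. *)
Lemma integral_continuous_gt0 (R : realType) (T : R) (u : R -> R) (t0 : R) :
  0 < T -> {within `[0, T], continuous u} -> (forall t, 0 <= u t) ->
  0 <= t0 <= T -> 0 < u t0 ->
  (0 < \int[lebesgue_measure]_(t in `[0%R, T]) (u t)%:E)%E.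
Proof.
move=> T0 cu u0 /andP[t00 t0T] ut0.
have mu_ : measurable_fun `[0, T] (EFin \o u).
  by apply/measurable_EFinP; exact: subspace_continuous_measurable_fun.
have t0I : `[0, T]%classic t0 by rewrite /= in_itv /= t00.
have d0 : 0 < u t0 / 2 by rewrite divr_gt0.
have /subspace_continuousP/(_ _ t0I)/cvgrPdist_lt/(_ _ d0) := cu.
move=> /nbhs_ballP[e /= e0 He].
pose l := Num.max 0 (t0 - e / 2); pose r := Num.min T (t0 + e / 2).
have lr : l < r.
  by rewrite gt_max !lt_min; apply/andP; split; apply/andP; split; lra.
have Ilr : `[l, r]%classic `<=` `[0, T]%classic.
  by apply: subset_itv; rewrite bnd_simp ?le_max ?ge_min lexx.
apply: (@lt_le_trans _ _
    (\int[lebesgue_measure]_(t in `[l, r]) cst (u t0 / 2)%:E t)%E).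
  rewrite integral_cst //= lebesgue_measure_itv /= lte_fin lr -EFinB -EFinM.
  by rewrite lte_fin mulr_gt0 // subr_gt0.
apply: (@le_trans _ _ (\int[lebesgue_measure]_(t in `[l, r]) (u t)%:E)%E).
  apply: ge0_le_integral => //=.
  - by move=> t _; rewrite lee_fin ltW.
  - by apply: measurable_funS mu_.
  move=> t tI; rewrite lee_fin.
  have /He /= : ball t0 e t.
    move: tI; rewrite /= in_itv /= ge_max le_min => /andP[/andP[_ ?] /andP[_ ?]].
    rewrite -ball_normE /= ltr_norml; apply/andP; split; lra.
  move=> /(_ (Ilr _ tI)); rewrite ltr_norml => /andP[_ ut].
  have half (a b : R) : a - b < a / 2 -> a / 2 <= b by lra.
  exact: half ut.
by apply: ge0_subset_integral => //= t _; rewrite lee_fin.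
Qed.

(** * Energy of the output difference *)

Lemma output_gap_cvg (R : realType) (n p : nat) (h : 'rV[R]_n -> 'rV[R]_p)
    (I : Type) (F : set_system I) (FF : Filter F) (z1 z2 : I -> 'rV[R]_n)
    (y1 y2 : 'rV[R]_n) :
  continuous h -> z1 i @[i --> F] --> y1 -> z2 i @[i --> F] --> y2 ->
  enorm (h (z1 i) - h (z2 i)) ^+ 2 @[i --> F] --> enorm (h y1 - h y2) ^+ 2.
Proof.
move=> ch c1 c2.
have cd : h (z1 i) - h (z2 i) @[i --> F] --> h y1 - h y2.
  by apply: cvgB; [exact: (cvg_comp z1 h c1 (ch _))
                  |exact: (cvg_comp z2 h c2 (ch _))].
have ce := cvg_comp _ (@enorm R p) cd (@enorm_continuous R p _).
by rewrite expr2; under eq_fun do rewrite expr2; exact: cvgM.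
Qed.

Definition output_energy (R : realType) (n p : nat)
    (h : 'rV[R]_n -> 'rV[R]_p) (phi : R -> 'rV[R]_n -> 'rV[R]_n) (T : R)
    (x1 x2 : 'rV[R]_n) : \bar R :=
  \int[lebesgue_measure]_(t in `[0%R, T])
    (enorm (h (phi t x1) - h (phi t x2)) ^+ 2)%:E.

Section OutputEnergy.
Variables (R : realType) (n p : nat) (f : 'rV[R]_n -> 'rV[R]_n).
Variables (h : 'rV[R]_n -> 'rV[R]_p) (Omega : set 'rV[R]_n) (tau : \bar R).
Variables (phi : R -> 'rV[R]_n -> 'rV[R]_n) (T : R).
Hypotheses (h_cont : continuous h) (phi_flow : is_flow f Omega tau phi).
Hypotheses (T_gt0 : 0 < T) (T_lt_tau : (T%:E < tau)%E).

Let gap (xy : 'rV[R]_n * 'rV[R]_n) (t : R) :=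
  enorm (h (phi t xy.1) - h (phi t xy.2)) ^+ 2.

Let itv_horizon : `[0, T]%classic `<=` horizon tau.
Proof.
move=> t; rewrite /= in_itv /= => /andP[t0 tT]; split=> //.
by apply: le_lt_trans T_lt_tau; rewrite lee_fin.
Qed.

Let gap_continuous (xy : 'rV[R]_n * 'rV[R]_n) :
  (Omega `*` Omega) xy -> {within `[0, T], continuous (gap xy)}.
Proof.
move=> [xO yO]; have [sol _ _] := phi_flow.
apply: (continuous_subspaceW itv_horizon).
have /subspace_continuousP cx := solution_continuous (sol _ xO).
have /subspace_continuousP cy := solution_continuous (sol _ yO).
apply/subspace_continuousP => t tH.
exact: output_gap_cvg h_cont (cx t tH) (cy t tH).
Qed.

Lemma output_energy_gt0 (x1 x2 : 'rV[R]_n) :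
  Omega x1 -> Omega x2 ->
  (exists2 t, 0 <= t <= T & h (phi t x1) <> h (phi t x2)) ->
  (0 < output_energy h phi T x1 x2)%E.
Proof.
move=> x1O x2O [t tT ht].
apply: (integral_continuous_gt0 T_gt0
  (@gap_continuous (x1, x2) (conj x1O x2O)) _ tT).
  by move=> s; rewrite /gap sqr_ge0.
rewrite /gap /= exprn_gt0 // lt_neqAle enorm_ge0 andbT eq_sym; apply/eqP.
by move=> /enorm_eq0/eqP; rewrite subr_eq0 => /eqP.
Qed.

Lemma output_energy_lsc (a b : 'rV[R]_n) (c : R) :
  Omega a -> Omega b -> (c%:E < output_energy h phi T a b)%E ->
  \forall xy \near (a, b), (Omega `*` Omega) xy ->
    (c%:E < output_energy h phi T xy.1 xy.2)%E.
Proof.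
move=> aO bO cab.
apply: (@lower_semicontinuous_integral _ _ _ lebesgue_measure `[0, T]%classic
  _ (Omega `*` Omega) gap (a, b) c) => //.
- move=> xy xyO; apply: subspace_continuous_measurable_fun => //.
  exact: gap_continuous.
- by move=> xy t; rewrite /gap sqr_ge0.
move=> t /itv_horizon tH.
have [_ _ /(_ t tH)/subspace_continuousP cphi] := phi_flow.
have c1 : xy.1 @[xy --> within (Omega `*` Omega) (nbhs (a, b))] -->
    within Omega (nbhs a).
  move=> V VO; exists ([set x | Omega x -> V x], setT).
    by split; [exact: VO | exact: filterT].
  by move=> [x y] /= [Vx _] [xO _]; exact: Vx.
have c2 : xy.2 @[xy --> within (Omega `*` Omega) (nbhs (a, b))] -->
    within Omega (nbhs b).
  move=> V VO; exists (setT, [set x | Omega x -> V x]).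
    by split; [exact: filterT | exact: VO].
  by move=> [x y] /= [_ Vy] [_ yO]; exact: Vy.
apply: output_gap_cvg => //.
  exact: cvg_comp c1 (cphi a aO).
exact: cvg_comp c2 (cphi b bO).
Qed.

(** Pairs near one at distance less than r satisfy no constraint, and near any
    other pair lower semicontinuity preserves a positive lower bound; compactness
    of Omega x Omega extracts one bound. *)
Lemma output_energy_bounded_below (r : R) :
  compact Omega -> 0 < r ->
  (forall x1 x2, Omega x1 -> Omega x2 -> x1 <> x2 ->
    exists2 t, 0 <= t <= T & h (phi t x1) <> h (phi t x2)) ->
  exists2 c, 0 < c & forall x1 x2, Omega x1 -> Omega x2 ->
    r <= enorm (x1 - x2) -> (c%:E <= output_energy h phi T x1 x2)%E.
Proof.
move=> cO r0 dist.
pose P (c : R) (xy : 'rV[R]_n * 'rV[R]_n) := r <= enorm (xy.1 - xy.2) ->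
  (c%:E <= output_energy h phi T xy.1 xy.2)%E.
have near_c : \forall c \near 0^'+, Omega `*` Omega `<=` P c.
  have /compact_near_coveringP/near_covering_withinP cover := compact_setX cO cO.
  apply: (cover R 0^'+ P _) => -[a b] [/= aO bO].
  have [abr|rab] := ltP (enorm (a - b)) r.
    have ce : enorm (xy.1 - xy.2) @[xy --> (a, b)] --> enorm (a - b).
      apply: (@cvg_comp _ _ _ (fun xy => xy.1 - xy.2) (@enorm R n) _
        (nbhs (a - b))); last exact: enorm_continuous.
      by apply: cvgB; [exact: cvg_fst | exact: cvg_snd].
    exists ([set xy | enorm (xy.1 - xy.2) < r], setT).
      split; last exact: filterT.
      exact: (cvgr_lt _ ce _ abr).
    by move=> [[x y] c] /= [xyr _] _; rewrite /P leNgt /= xyr.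
  have ab : a <> b.
    move=> E; move: rab; rewrite E subrr.
    rewrite /enorm big1 ?sqrtr0 ?leNgt ?r0 // => i _.
    by rewrite mxE expr0n.
  have [c0 c00 c0E] :=
    EFin_lt_between (output_energy_gt0 aO bO (dist _ _ aO bO ab)).
  exists ([set xy | (Omega `*` Omega) xy ->
      (c0%:E < output_energy h phi T xy.1 xy.2)%E], [set c | c < c0]).
    by split; [exact: output_energy_lsc | exact: nbhs_right_lt].
  move=> [[x y] c] /= [Hxy cc0] xyO _; apply: le_trans (ltW (Hxy xyO)).
  by rewrite lee_fin ltW.
have [c [c0 Hc]] : exists c, 0 < c /\ Omega `*` Omega `<=` P c.
  apply: (@filter_ex _ (0^'+ : set_system R)).
  by near=> c; split; near: c => //; exact: nbhs_right_gt.
by exists c => // x1 x2 x1O x2O; exact: (Hc (x1, x2)).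
Unshelve. all: by end_near. Qed.

End OutputEnergy.

(** * K-functions below a family of values *)

(** A is meant as a set of (distance, energy) pairs.  The penalty for distances
    below r has slope 1, which makes the infimum 1-Lipschitz in r whatever the
    regularity of the energies. *)
Definition distance_penalized_inf (R : realType) (A : set (R * R)) (r : R) : R :=
  inf [set q.2 + Num.max 0 (r - q.1) | q in A].

Section KMinorant.
Variables (R : realType) (A : set (R * R)).
Hypotheses (A00 : A (0, 0)) (A_ge0 : forall q, A q -> 0 <= q.1 /\ 0 <= q.2).
Hypothesis A_pos : forall r, 0 < r ->
  exists2 c, 0 < c & forall q, A q -> r <= q.1 -> c <= q.2.

Let beta := distance_penalized_inf A.

Let beta_le (q : R * R) (r : R) : A q -> beta r <= q.2 + Num.max 0 (r - q.1).
Proof.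
move=> Aq; apply: ge_inf; last by exists q.
exists 0 => _ [s /A_ge0[_ s0] <-].
by rewrite addr_ge0 // le_max lexx.
Qed.

Let le_beta (r c : R) :
  (forall q, A q -> c <= q.2 + Num.max 0 (r - q.1)) -> c <= beta r.
Proof.
move=> H; apply: lb_le_inf; first by eexists; exists (0, 0).
by move=> _ [q Aq <-]; exact: H.
Qed.

Let beta_homo (r s : R) : r <= s -> beta r <= beta s.
Proof.
move=> rs; apply: le_beta => q Aq; apply: le_trans (beta_le r Aq) _.
by rewrite lerD2l ge_max !le_max lexx /= lerD2r rs orbT.
Qed.

Let beta_lip (r s : R) : r <= s -> beta s <= beta r + (s - r).
Proof.
move=> rs; rewrite -lerBlDr; apply: le_beta => q Aq.
rewrite lerBlDr; apply: le_trans (beta_le s Aq) _.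
rewrite -addrA lerD2l ge_max; apply/andP; split.
  by rewrite addr_ge0 ?subr_ge0 // le_max lexx.
have : r - q.1 <= Num.max 0 (r - q.1) by rewrite le_max lexx orbT.
lra.
Qed.

(** A pair at distance at least r / 2 has energy bounded below, and any other pair
    pays a penalty of at least r / 2. *)
Let beta_gt0 (r : R) : 0 < r -> 0 < beta r.
Proof.
move=> r0; have r20 : 0 < r / 2 by rewrite divr_gt0.
have [c c0 Hc] := A_pos r20.
apply: (@lt_le_trans _ _ (Num.min c (r / 2))); first by rewrite lt_min c0.
apply: le_beta => q Aq; rewrite ge_min.
have [/(Hc q Aq) cq|qr] := leP (r / 2) q.1.
  by rewrite (le_trans cq) // lerDl le_max lexx.
apply/orP; right; have [_ q0] := A_ge0 Aq.
apply: (@le_trans _ _ (r - q.1)); first lra.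
by rewrite ler_wpDl // le_max lexx orbT.
Qed.

Let beta_continuous : continuous beta.
Proof.
move=> r; apply/cvgrPdist_lt => e e0; apply/nbhs_ballP; exists e => //= s.
rewrite /ball /= => rs; apply: le_lt_trans rs.
have [rs'|/ltW sr] := leP r s.
  have b1 := beta_homo rs'; have b2 := beta_lip rs'.
  by rewrite distrC (distrC r) !ger0_norm ?subr_ge0 // lerBlDl.
have b1 := beta_homo sr; have b2 := beta_lip sr.
by rewrite !ger0_norm ?subr_ge0 // lerBlDl.
Qed.

(** The infimum beta is only nondecreasing; the factor r / (1 + |r|) makes it
    strictly increasing, and, being less than 1, keeps it below the energies.  The
    absolute value makes this factor continuous on the whole line. *)
Lemma K_function_minorant : exists alpha : R -> R,
  K_function `[0, +oo[%classic alpha /\ forall q, A q -> alpha q.1 <= q.2.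
Proof.
pose g (r : R) := r / (1 + `|r|).
have g1 (r : R) : 0 < 1 + `|r| by rewrite ltr_wpDr.
have g_ge0 r : 0 <= r -> 0 <= g r by move=> r0; rewrite divr_ge0 // ltW.
have g_lt1 r : g r < 1.
  by rewrite ltr_pdivrMr // mul1r; have := ler_norm r; lra.
have g_cont : continuous g.
  move=> r; apply: cvgM; first exact: cvg_id.
  apply: cvgV; first by rewrite gt_eqF.
  by apply: cvgD; [exact: cvg_cst | exact: norm_continuous].
have g_lt r s : 0 <= r -> r < s -> g r < g s.
  move=> r0 rs; have s0 := le_lt_trans r0 rs.
  rewrite /g !ger0_norm ?(ltW s0) // ltr_pdivrMr ?ltr_wpDr //.
  rewrite mulrAC ltr_pdivlMr ?ltr_wpDr ?(ltW s0) //; nra.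
have ge0 r : `[0, +oo[%classic r -> 0 <= r by rewrite /= in_itv /= andbT.
have beta_ge0 r : 0 <= r -> 0 <= beta r.
  move=> r0; apply: le_beta => q /A_ge0[_ q0].
  by rewrite addr_ge0 // le_max lexx.
exists (fun r => beta r * g r); split.
  split.
  - by left.
  - by move=> r /ge0 r0; rewrite mulr_ge0 ?beta_ge0 ?g_ge0.
  - apply: continuous_subspaceT => r.
    by apply: cvgM; [exact: beta_continuous | exact: g_cont].
  - move=> r s /ge0 r0 /ge0 s0 rs.
    apply: (@le_lt_trans _ _ (beta s * g r)).
      by rewrite ler_wpM2r ?g_ge0 // beta_homo // ltW.
    by rewrite ltr_pM2l ?g_lt // beta_gt0 // (le_lt_trans r0).
  - by rewrite /g mul0r mulr0.
move=> q Aq; have [q1 q2] := A_ge0 Aq.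
apply: (@le_trans _ _ (beta q.1)).
  by rewrite ler_piMr ?beta_ge0 // ltW.
by apply: le_trans (beta_le _ Aq) _; rewrite subrr maxxx addr0.
Qed.

End KMinorant.

(** * K-observability *)

Theorem proposition9 (R : realType) (n p : nat)
    (f : 'rV[R]_n -> 'rV[R]_n) (h : 'rV[R]_n -> 'rV[R]_p)
    (Omega : set 'rV[R]_n) (tau : \bar R)
    (phi : R -> 'rV[R]_n -> 'rV[R]_n)
    (f_cont : continuous f) (h_cont : continuous h)
    (Omega_compact : compact Omega)
    (tau_gt0 : (0 < tau)%E)
    (phi_flow : is_flow f Omega tau phi)
    (D_obs : D_observable h Omega tau phi)
    (R_obs : R_observable f h Omega) :
  K_observable h Omega tau phi.
Proof.
have [N [_ Ch Cf rk]] := R_obs.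
have [T [T0 Ttau dist]] := uniform_distinguishing_time h_cont Omega_compact
  tau_gt0 phi_flow D_obs Ch Cf rk.
have {}dist x1 x2 : Omega x1 -> Omega x2 -> x1 <> x2 ->
    exists2 t, 0 <= t <= T & h (phi t x1) <> h (phi t x2).
  move=> x1O x2O x12; apply: contrapT => nex; apply: x12.
  apply: dist => // t tT.
  by apply: contrapT => ht; apply: nex; exists t.
(* Truncating at 1 makes the energies real numbers. *)
pose E x1 x2 : \bar R := mine (output_energy h phi T x1 x2) 1%E.
have E_ge0 x1 x2 : (0 <= E x1 x2)%E.
  rewrite le_min lee01 andbT; apply: integral_ge0 => t _.
  by rewrite lee_fin sqr_ge0.
have E_fin x1 x2 : E x1 x2 \is a fin_num.
  rewrite fin_numE; apply/andP; split; apply/eqP => Einf.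
    by have := E_ge0 x1 x2; rewrite Einf.
  have : (E x1 x2 <= 1)%E by rewrite ge_min lexx orbT.
  by rewrite Einf.
(* Adding (0, 0) keeps the set nonempty when Omega is empty. *)
pose A := [set q : R * R | q = (0, 0) \/ exists x1 x2,
  [/\ Omega x1, Omega x2 & q = (enorm (x1 - x2), fine (E x1 x2))]].
have A00 : A (0, 0) by left.
have A_ge0 q : A q -> 0 <= q.1 /\ 0 <= q.2.
  move=> [->|[x1 [x2 [_ _ ->]]]] //; split; first exact: enorm_ge0.
  exact: fine_ge0.
have A_pos r : 0 < r ->
    exists2 c, 0 < c & forall q, A q -> r <= q.1 -> c <= q.2.
  move=> r0; have [c c0 Hc] := output_energy_bounded_below h_cont phi_flow T0
    Ttau Omega_compact r0 dist.
  exists (Num.min c 1); first by rewrite lt_min c0 /=.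
  move=> q [->|[x1 [x2 [x1O x2O ->]]]] /= rq; first by rewrite leNgt r0 in rq.
  rewrite -lee_fin fineK // le_min; apply/andP; split.
    by apply: le_trans (Hc _ _ x1O x2O rq); rewrite lee_fin ge_min lexx.
  by rewrite lee_fin ge_min lexx orbT.
have [alpha [Kalpha alpha_le]] := K_function_minorant A00 A_ge0 A_pos.
exists T; split=> //; exists `[0, +oo[%classic, alpha; split=> //.
  by move=> x1 x2 _ _; rewrite /= in_itv /= enorm_ge0.
move=> x1 x2 x1O x2O.
apply: (@le_trans _ _ (E x1 x2)); last by rewrite ge_min lexx.
rewrite -(fineK (E_fin _ _)) lee_fin.
by apply: (alpha_le (enorm (x1 - x2), fine (E x1 x2))); right; exists x1, x2.
Qed.
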